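(* Let $(\mathcal{X},\mathcal{C})$ be a measurement scenario and let $\mathcal{E}=(p_C)_{C\in\mathcal{C}}$ be an empirical model on it. Then $\mathcal{E}$ can be realised as a trivial probability bundle over $(\mathcal{X},\mathcal{C})$ if and only if $\mathcal{E}$ is non contextual.
   Context: A measurement $\mathcal{M}$ is a nonempty countable set (of outcome labels), with $\sigma$-algebra its power set. For a set $S$ of measurements, the joint measurement of $S$ is $\prod_{\mathcal{M}\in S}\mathcal{M}$ with the product $\sigma$-algebra. A probability distribution on it means a probability measure; when the product is countable this is the same as a function $p\ge 0$ with $\sum p=1$. For $T\subseteq S$, the marginal on $T$ of a distribution $p$ on $\prod_{\mathcal{M}\in S}\mathcal{M}$ is its push-forward along the coordinate projection; in the countable case, $p_T(\mathbf{s})=\sum_{\mathbf{m}|_T=\mathbf{s}}p(\mathbf{m})$. A (measurement) scenario is a pair $(\mathcal{X},\mathcal{C})$ where $\mathcal{X}$ is a collection of measurements and $\mathcal{C}$ is a compatibility cover: a collection of subsets of $\mathcal{X}$ (maximal contexts; in particular none is properly contained in another) such that every $\mathcal{M}\in\mathcal{X}$ belongs to at least one $C\in\mathcal{C}$. Which subsets of measurements are compatible is part of the data of the scenario. An empirical model on $(\mathcal{X},\mathcal{C})$ is a family $(p_C)_{C\in\mathcal{C}}$ with $p_C$ a probability distribution on $\prod_{\mathcal{M}\in C}\mathcal{M}$. It is non contextual if there is a probability distribution $p_{\mathcal{X}}$ on $\prod_{\mathcal{M}\in\mathcal{X}}\mathcal{M}$ such that, for every $C\in\mathcal{C}$, the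 marginal of $p_{\mathcal{X}}$ on $C$ equals $p_C$. A realisation of a (joint) measurement in a measurable space $(\Omega,\Sigma)$ is a partition of $\Omega$ into elements of $\Sigma$ indexed by the outcomes (cells may be empty); equivalently, a measurable map from $(\Omega,\Sigma)$ to the outcome set. A probability fibre bundle over $(\mathcal{X},\mathcal{C})$ attaches to each $C\in\mathcal{C}$ a probability space $(\Omega^C,\Sigma^C,\mu^C)$ with a realisation $\mathsf{m}_C:\Omega^C\to\prod_{\mathcal{M}\in C}\mathcal{M}$ of the joint measurement of $C$. Whenever $C\cap C'\neq\emptyset$, the coarsenings of $\Sigma^C$ and $\Sigma^{C'}$ generated by the outcomes of the measurements in $C\cap C'$ are identified by matching outcome labels, and the measures induced on them are required to agree: the push-forwards of $\mu^C$ and $\mu^{C'}$ to $\prod_{\mathcal{M}\in C\cap C'}\mathcal{M}$ coincide. The bundle realises $\mathcal{E}$ if the push-forward of $\mu^C$ along $\mathsf{m}_C$ equals $p_C$ for every $C\in\mathcal{C}$. A probability fibre bundle is trivial if it is the restriction of a global product equipped with a global probability measure. That is, for each $\mathcal{M}\in\mathcal{X}$ there are a measurable space $(\Omega^{\mathcal{M}},\Sigma^{\mathcal{M}})$ and a realisation $\mathsf{m}_{\mathcal{M}}:\Omega^{\mathcal{M}}\to\mathcal{M}$ such that, for every $C\in\mathcal{C}$, $(\Omega^C,\Sigma^C)=\prod_{\mathcal{M}\in C}(\Omega^{\mathcal{M}},\Sigma^{\mathcal{M}})$ and $\mathsf{m}_C=\prod_{\mathcal{M}\in C}\mathsf{m}_{\mathcal{M}}$;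 and there is a probability measure $\mu$ on $\prod_{\mathcal{M}\in\mathcal{X}}(\Omega^{\mathcal{M}},\Sigma^{\mathcal{M}})$ such that, for every $C\in\mathcal{C}$, $\mu^C$ is the push-forward of $\mu$ under the projection to $\prod_{\mathcal{M}\in C}\Omega^{\mathcal{M}}$. *)

(* Defs.v *)
From HB Require Import structures.
From mathcomp Require Import all_boot all_order all_algebra.
From mathcomp Require Import all_classical all_reals all_analysis.

Set Implicit Arguments.
Unset Strict Implicit.
Unset Printing Implicit Defensive.

Import Order.TTheory GRing.Theory Num.Theory.
Local Open Scope classical_set_scope.

(* Arbitrary products of measurable spaces, with the product sigma-algebra,
   i.e. the one generated by the coordinate maps. *)

Definition prod_display {I : Type} (d : I -> measure_display) :
  measure_display.
Proof. exact: default_measure_display. Qed.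

Definition mprod {I : Type} {d : I -> measure_display}
  (T : forall i, measurableType (d i)) : Type := forall i, T i.

Definition mcoord {I : Type} {d : I -> measure_display}
  (T : forall i, measurableType (d i)) (i : I) : mprod T -> T i := fun f => f i.

Definition cylinders {I : Type} {d : I -> measure_display}
  (T : forall i, measurableType (d i)) : set (set (mprod T)) :=
  \bigcup_i preimage_set_system setT (mcoord (T := T) i) measurable.

Arguments cylinders {I d} T _.

Section mprod_measurable.
Context {I : Type} {d : I -> measure_display}.
Variable T : forall i, measurableType (d i).

HB.instance Definition _ := Pointed.copy (mprod T) (forall i, T i).

Let mprod0 : <<s cylinders T >> set0.
Proof. exact: sigma_algebra0. Qed.

Let mprodC (A : set (mprod T)) :
  <<s cylinders T >> A -> <<s cylinders T >> (~` A).
Proof. exact: sigma_algebraC. Qed.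

Let mprod_bigcup (F : (set (mprod T))^nat) :
  (forall i, <<s cylinders T >> (F i)) -> <<s cylinders T >> (\bigcup_i F i).
Proof. exact: sigma_algebra_bigcup. Qed.

HB.instance Definition _ := @isMeasurable.Build (prod_display d)
  (mprod T) <<s cylinders T >> mprod0 mprodC mprod_bigcup.

End mprod_measurable.

Section subproducts.
Context {X : Type} {d : X -> measure_display}.
Variable T : forall x, measurableType (d x).

(* The product of the T x for x in the set D. *)
Definition sprod (D : set X) : Type := mprod (fun x : D => T (\val x)).
HB.instance Definition _ (D : set X) := Measurable.on (sprod D).

Definition sproj (D E : set X) (DE : D `<=` E) (f : sprod E) : sprod D :=
  fun x => f (subfun DE x).

End subproducts.

(* A pointed type is the library's form of a nonempty type. *)
Record measurement := Measurement {
  labels : pointedType;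
  labels_countable : countable [set: labels]
}.

(* The outcome set, with its power set as sigma-algebra. *)
Definition outcome (M : measurement) : Type := labels M.
HB.instance Definition _ (M : measurement) :=
  Pointed.copy (outcome M) (labels M).
HB.instance Definition _ (M : measurement) :=
  @isMeasurable.Build default_measure_display (outcome M)
    discrete_measurable discrete_measurable0
    discrete_measurableC discrete_measurableU.

(* The collection of measurements is an indexed family, so that two of its
   members may carry the same outcome labels. *)
Record scenario := Scenario {
  midx : Type;
  meas : midx -> measurement;
  contexts : set (set midx);
  contexts_cover : \bigcup_(C in contexts) C = [set: midx];
  contexts_maximal : forall C C', contexts C -> contexts C' ->
    C `<=` C' -> C = C'
}.

Arguments contexts s _ : clear implicits.

Definition joint (S : scenario) (D : set (midx S)) : Type :=
  sprod (fun M => outcome (meas M) : measurableType _) D.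
HB.instance Definition _ (S : scenario) (D : set (midx S)) :=
  Measurable.on (joint D).

Section models.
Variables (R : realType) (S : scenario).

Definition marginal (D E : set (midx S)) (DE : D `<=` E)
  (p : set (joint E) -> \bar R) : set (joint D) -> \bar R :=
  pushforward p (sproj DE : joint E -> joint D).

Definition empirical_model := forall C : contexts S,
  probability (joint (\val C)) R.

Definition noncontextual (E : empirical_model) : Prop :=
  exists p : probability (joint [set: midx S]) R,
    forall (C : contexts S) (A : set (joint (\val C))), measurable A ->
      marginal (@subsetT _ (\val C)) p A = E C A.

Record bundle := Bundle {
  fdisp : contexts S -> measure_display;
  fibre : forall C, measurableType (fdisp C);
  fmu : forall C, probability (fibre C) R;
  freal : forall C, {mfun fibre C >-> joint (\val C)};
  fagree : forall C C' : contexts S, \val C `&` \val C' !=set0 ->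
    forall A : set (joint (\val C `&` \val C')), measurable A ->
      marginal (@subIsetl _ (\val C) (\val C')) (pushforward (fmu C) (freal C)) A =
      marginal (@subIsetr _ (\val C) (\val C')) (pushforward (fmu C') (freal C')) A
}.

Definition realises (B : bundle) (E : empirical_model) : Prop :=
  forall (C : contexts S) (A : set (joint (\val C))), measurable A ->
    pushforward (fmu B C) (freal B C) A = E C A.

Definition prod_real (d : midx S -> measure_display)
  (Omega : forall M, measurableType (d M))
  (m : forall M, {mfun Omega M >-> outcome (meas M)})
  (D : set (midx S)) : sprod Omega D -> joint D :=
  fun w M => m (\val M) (w M).

(* The equation (Omega^C, Sigma^C) = product is rendered as an equality e of
   carriers along which the sigma-algebras, realisations and measures
   coincide. It is not stated as an equality of measurableType structures,
   which would also compare their chosen points and choice operators, nor are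
   the measures compared on nonmeasurable sets, where their values are junk. *)
Definition is_trivial (B : bundle) : Prop :=
  exists (d : midx S -> measure_display)
         (Omega : forall M, measurableType (d M))
         (m : forall M, {mfun Omega M >-> outcome (meas M)})
         (mu : probability (sprod Omega [set: midx S]) R),
  forall C : contexts S,
  exists e : (fibre B C : Type) = sprod Omega (\val C),
    let cast (w : fibre B C) : sprod Omega (\val C) := ecast T T e w in
    [/\ forall A : set (sprod Omega (\val C)),
          measurable A <-> measurable (cast @^-1` A),
        forall w, freal B C w = prod_real m (cast w) &
        forall A : set (sprod Omega (\val C)), measurable A ->
          fmu B C (cast @^-1` A) =
          pushforward mu (sproj (@subsetT _ (\val C)) :
            _ -> sprod Omega (\val C)) A].

End models.

(* Main.v *)
(* A global measure [mu] on the total space pushes forward along the global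
   realisation to a measure on the global outcome space. Since realising
   outcomes commutes with restricting to a context, its marginals are the
   [p_C]. Conversely, the outcome spaces themselves, with identity realisations
   and a global distribution as global measure, form a trivial bundle. *)

From HB Require Import structures.
Require Import Defs.
From mathcomp Require Import all_boot all_order all_algebra.
From mathcomp Require Import all_classical all_reals all_analysis.

Local Open Scope classical_set_scope.

(** Lets [idfun] serve as a bundled realisation of an outcome space by itself. *)
HB.instance Definition _ (d : measure_display) (T : measurableType d) :=
  isMeasurableFun.Build d d T T (@idfun T) (@measurable_id _ T setT).

Section mprod_theory.
Context {I : Type} {d : I -> measure_display}.
Variable T : forall i, measurableType (d i).

Lemma measurable_mcoord (i : I) : measurable_fun setT (mcoord (T := T) i).
Proof.
move=> _ A mA; apply: sub_sigma_algebra.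
by exists i => //; exists A.
Qed.

(** It suffices to test generators, and the preimage of a cylinder under [f] is a preimage under a
    single component. *)
Lemma measurable_fun_mprod (d' : measure_display) (aT : measurableType d')
    (f : aT -> mprod T) :
  (forall i, measurable_fun setT (fun a => f a i)) -> measurable_fun setT f.
Proof.
move=> mf; apply: (measurability (cylinders T)) => //.
move=> _ [_ [i _ [A mA <-]] <-].
by rewrite !setTI; have := mf i measurableT A mA; rewrite setTI.
Qed.

End mprod_theory.

Section sprod_theory.
Context {X : Type} {d : X -> measure_display}.
Variable T : forall x, measurableType (d x).

Lemma measurable_sproj (D E : set X) (DE : D `<=` E) :
  measurable_fun setT (sproj DE : sprod T E -> sprod T D).
Proof.
apply: measurable_fun_mprod => x.
exact: (measurable_mcoord (fun x : E => T (\val x)) (subfun DE x)).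
Qed.

(** Both sides read [f] at the same index, up to the proof that it lies in [F]. *)
Lemma sproj_comp (D E F : set X) (DE : D `<=` E) (EF : E `<=` F)
    (DF : D `<=` F) (f : sprod T F) :
  sproj DE (sproj EF f) = sproj DF f.
Proof.
apply: functional_extensionality_dep => x; rewrite /sproj /subfun /=.
by congr (f (SigSub _)); exact: Prop_irrelevance.
Qed.

End sprod_theory.

Lemma measurable_prod_real (S : scenario) (d : midx S -> measure_display)
    (Omega : forall M, measurableType (d M))
    (m : forall M, {mfun Omega M >-> outcome (meas M)}) (D : set (midx S)) :
  measurable_fun setT (prod_real m (D := D)).
Proof.
apply: measurable_fun_mprod => x.
apply: (measurableT_comp (measurable_funPT (m (\val x)))).
exact: (measurable_mcoord (fun x : D => Omega (\val x)) x).
Qed.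

Theorem theorem4p1 (R : realType) (S : scenario) (E : empirical_model R S) :
  (exists B : bundle R S, is_trivial B /\ realises B E) <-> noncontextual E.
Proof.
split=> [[B [[d [W [m [mu Bmu]]]] BE]]|[p pE]].
- pose g : {mfun sprod W setT >-> joint [set: midx S]} :=
    HB.pack (prod_real m (D := setT))
      (isMeasurableFun.Build _ _ _ _ _ (measurable_prod_real _ _ _ m setT)).
  exists (distribution mu g) => C A mA; rewrite -BE//.
  have [e [_ realE muE]] := Bmu C.
  have mA' : measurable (prod_real m (D := \val C) @^-1` A : set (sprod W (\val C))).
    by rewrite -[X in measurable X]setTI; exact: measurable_prod_real.
  rewrite /pushforward.
  (* Since [muE] only evaluates [fmu B C] on preimages under the cast, the realisation is factored
     through it. *)
  have -> : freal B C @^-1` A =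
      (fun w => ecast T T e w) @^-1` (prod_real m (D := \val C) @^-1` A).
    by apply/seteqP; split=> w /=; rewrite realE.
  (* The two preimages under [mu] now agree by computation, coordinate by coordinate. *)
  by rewrite muE.
(* Both sides are the marginal of [p] on the overlap, reached through [C] and through [C']. *)
- have agree (C C' : contexts S) : \val C `&` \val C' !=set0 ->
      forall A : set (joint (\val C `&` \val C')), measurable A ->
      marginal (@subIsetl _ (\val C) (\val C')) (pushforward (E C) idfun) A =
      marginal (@subIsetr _ (\val C) (\val C')) (pushforward (E C') idfun) A.
    move=> _ A mA; rewrite /marginal /pushforward -!pE; last 2 first.
    + rewrite -[X in measurable X]setTI; exact: measurable_sproj.
    + rewrite -[X in measurable X]setTI; exact: measurable_sproj.
    rewrite /marginal /pushforward; congr (p _).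
    apply/seteqP; split=> w /=;
      by rewrite !(sproj_comp _ _ _ _ _ _ (@subsetT _ _)).
  exists (@Bundle R S _ _ (fun C => E C) (fun C => idfun) agree).
  split=> //.
  exists _, (fun M => outcome (meas M) : measurableType _),
    (fun M => idfun), p => C.
  (* The fibres are these products by definition, so the cast is the identity and only the measures
     remain to be compared. *)
  exists erefl; split=> //= A mA.
  by rewrite -pE.
Qed.
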